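(* Let $q$ be a prime power. Let $s_A(n,q)$ be the proportion of separable elements in $A(n,q)$ and $s_{GL}(n,q)$ the proportion of separable elements in $GL(n,q)$, and $S_A(u,q)=\sum_{n\ge0}s_A(n,q)u^n$, $S_{GL}(u,q)=\sum_{n\ge0}s_{GL}(n,q)u^n$. Then as formal power series \[ S_A(u,q)=\prod_{d\ge1}\Bigl(1+\frac{u^d}{q^d-1}\Bigr)^{N'(d,q)}=\frac{S_{GL}(u,q)}{1+\frac{u}{q-1}}. \]
   Context: $A(n,q)$ is the group of matrices $x\in GL(n+1,q)$ with $x_{11}=1$ and $x_{j1}=0$ for $j\ge2$. A matrix is separable if its characteristic polynomial is square-free (elements of $A(n,q)$ are viewed in $GL(n+1,q)$). $GL(0,q)$ is the trivial group, so $s_{GL}(0,q)=1$. $N(d,q)$ is the number of monic irreducible polynomials of degree $d$ over $\mathbb{F}_q$; $N'(d,q)=N(d,q)$ for $d>1$ and $N'(1,q)=N(1,q)-2=q-2$. *)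

(* Defs.v *)
From HB Require Import structures.
From mathcomp Require Import all_boot all_order all_algebra.
From mathcomp Require Import boolp.
Set Implicit Arguments. Unset Strict Implicit. Unset Printing Implicit Defensive.
Import Order.TTheory GRing.Theory Num.Theory.
Local Open Scope ring_scope.

Definition sqfree (F : fieldType) (p : {poly F}) : Prop :=
  forall d : {poly F}, d * d %| p -> (size d <= 1)%N.

Definition separable_mx (F : fieldType) (n : nat) (x : 'M[F]_n) : bool :=
  `[< sqfree (char_poly x) >].

Definition GLset (F : finFieldType) (n : nat) : {set 'M[F]_n} :=
  [set x : 'M[F]_n | x \in unitmx].

Definition Aset (F : finFieldType) (n : nat) : {set 'M[F]_n.+1} :=
  [set x : 'M[F]_n.+1 | (x \in unitmx) && (x ord0 ord0 == 1)
      && [forall j : 'I_n.+1, (j != ord0) ==> (x j ord0 == 0)]].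

Definition s_GL (F : finFieldType) (n : nat) : rat :=
  #|[set x in GLset F n | separable_mx x]|%:R / #|GLset F n|%:R.

Definition s_A (F : finFieldType) (n : nat) : rat :=
  #|[set x in Aset F n | separable_mx x]|%:R / #|Aset F n|%:R.

(* N(d,q): number of monic irreducible polynomials of degree d over F;
   monic polynomials of degree d are 'X^d + \poly_(i < d) c`_i, c : d.-tuple F *)
Definition Nirr (F : finFieldType) (d : nat) : nat :=
  #|[set c : d.-tuple F |
      `[< irreducible_poly ('X^d + \poly_(i < d) c`_i) >]]|.

Definition Nirr' (F : finFieldType) (d : nat) : nat :=
  if d == 1%N then (Nirr F 1 - 2)%N else Nirr F d.

Definition factor (q d : nat) : {poly rat} :=
  1 + ((q ^ d)%:R - 1)^-1 *: 'X^d.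

(* Main.v *)
Require Import Defs.
From HB Require Import structures.
From mathcomp Require Import all_boot all_order all_algebra.
From mathcomp Require Import all_field boolp.
Set Implicit Arguments. Unset Strict Implicit. Unset Printing Implicit Defensive.
Import GRing.Theory Num.Theory.
Local Open Scope ring_scope.

(* For a square-free monic f of degree n, sending a matrix A with characteristic
   polynomial f and a cyclic vector v of A to the matrix with rows v A^i is a
   bijection onto GL(n,q). Every such A is cyclic, and its cyclic vectors are in
   bijection with the units of F[X]/(f), so f is the characteristic polynomial of
   a proportion 1 / prod (q^d - 1) of GL(n,q), d ranging over the degrees of the
   irreducible factors of f. Summing over sets of irreducible factors gives the
   Euler product. An element of A(n,q) is [1 v; 0 y] with y in GL(n,q), and is
   separable iff y is separable without eigenvalue 1: the factor of X - 1 is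
   dropped from the product for GL(n,q). *)

(** * Irreducible factors and square-free polynomials *)

Lemma exists_irreducible_factor (F : fieldType) (p : {poly F}) :
  (1 < size p)%N -> exists2 f, irreducible_poly f & f %| p.
Proof.
have [m] := ubnP (size p); elim: m p => // m IHm p lepm p_gt1.
have [irr_p|] := pselect (irreducible_poly p); first by exists p.
move=> nirr; have: ~ forall d : {poly F}, size d != 1 -> d %| p -> d %= p.
  by move=> H; apply: nirr.
move/existsNP=> [d] /not_implyP[d_n1 /not_implyP[dvd_dp /negP neq_dp]].
have p_n0 : p != 0 by rewrite -size_poly_gt0 ltnW.
have d_n0 : d != 0 by apply: contraNneq p_n0 => d0; rewrite -dvd0p -d0.
have lt_dp : (size d < size p)%N.
  by rewrite ltn_neqAle (dvdp_size_eqp dvd_dp) neq_dp dvdp_leq.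
have [||f irr_f dvd_fd] := IHm d.
- exact: leq_trans lt_dp _.
- by rewrite ltn_neqAle eq_sym d_n1 size_poly_gt0.
- by exists f => //; apply: dvdp_trans dvd_fd dvd_dp.
Qed.

Lemma sqfree_dvdp (F : fieldType) (p d : {poly F}) :
  d %| p -> sqfree p -> sqfree d.
Proof. by move=> dvd_dp sf e dvd_ed; apply: sf; apply: dvdp_trans dvd_dp. Qed.

Lemma sqfree_mul_coprimep (F : fieldType) (f g : {poly F}) :
  irreducible_poly f -> sqfree (f * g) -> coprimep f g.
Proof.
move=> irr_f sf; rewrite irreducible_poly_coprime //; apply/negP=> dvd_fg.
by have := sf f (dvdp_mul (dvdpp f) dvd_fg); rewrite leqNgt irr_f.
Qed.

(** * Krylov matrices and cyclic vectors *)

Section Krylov.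
Variables (F : fieldType) (n : nat).
Implicit Types (A P : 'M[F]_n.+1) (u v w : 'rV[F]_n.+1) (p f g : {poly F}).

(** Invertible exactly when [v] is a cyclic vector of [A]. *)
Definition krylov A v : 'M[F]_n.+1 := \matrix_(i < n.+1) (v *m (A ^+ i)).

(** Reads combinations of the rows as polynomials in [A] of degree at most [n] applied to [v], so
    that independence becomes a matter of divisibility. *)
Lemma mul_krylov A v u : u *m krylov A v = v *m horner_mx A (rVpoly u).
Proof.
rewrite mulmx_sum_row /horner_mx /horner_morph /=.
rewrite (@horner_coef_wide _ n.+1); last first.
  exact: leq_trans (size_poly _ _) (size_poly _ _).
rewrite mulmx_sumr; apply: eq_bigr => i _.
by rewrite rowK coef_map /= coef_rVpoly_ord -mulmxE mul_scalar_mx scalemxAr.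
Qed.

Lemma krylov_mul A v p :
  krylov A (v *m horner_mx A p) = krylov A v *m horner_mx A p.
Proof.
apply/row_matrixP=> i; rewrite row_mul !rowK -!mulmxA; congr (_ *m _).
rewrite mulmxE; apply: commrX.
by have := comm_horner_mx2 A p 'X; rewrite horner_mx_X.
Qed.

Lemma horner_mx_rowM A v p g :
  v *m horner_mx A (p * g) = v *m horner_mx A p *m horner_mx A g.
Proof. by rewrite rmorphM -mulmxE mulmxA. Qed.

(** Over the field obtained by adjoining a root [z] of [f], [z] is an eigenvalue of [A]. An
    eigenvector is killed by [X - z], hence by [f], and the existence of a nonzero vector killed by
    [f] descends to the base field. *)
Lemma eigenpoly_irreducible_factor A f :
  irreducible_poly f -> f %| char_poly A -> eigenpoly A f.
Proof.
move=> irr_f dvd_f; have [L _ [z fz0 _]] := irredp_FAdjoin irr_f.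
rewrite -(eigenpoly_map (in_alg L)).
have: root (char_poly (map_mx (in_alg L) A)) z.
  by rewrite -map_char_poly; apply: root_dvdp fz0; rewrite dvdp_map.
rewrite -eigenvalue_root_char eigenvalue_poly => /eigenpolyP[v le_v v_n0].
apply/eigenpolyP; exists v => //.
move: fz0; rewrite -dvdp_XsubCl => /dvdpP[g ->].
move: le_v; rewrite /kermxpoly !sub_kermx mulrC rmorphM -mulmxE mulmxA.
by move=> /eqP ->; rewrite mul0mx.
Qed.

(** Induction on the degree: split off an irreducible [f] from [g = f * h]. Square-freeness makes
    [f] and [h] coprime, so if [u] is nonzero and killed by [f], and [w] has annihilator [h], then
    [u + w] has annihilator [f * h]. *)
Lemma exists_annihilated_by A g : sqfree (char_poly A) -> g %| char_poly A ->
  exists v, forall p, (v *m horner_mx A p == 0) = (g %| p).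
Proof.
move=> sfA; have [m] := ubnP (size g); elim: m g => // m IHm g le_gm dvd_gA.
have g_n0 : g != 0.
  apply: contraTneq dvd_gA => ->; rewrite dvd0p; apply: monic_neq0.
  exact: char_poly_monic.
have [g_le1|g_gt1] := leqP (size g) 1.
  (* A nonzero constant divides everything, and everything kills the zero vector. *)
  exists 0 => p; rewrite mul0mx eqxx; apply/esym.
  have /eqp_dvdl -> : g %= 1.
    by rewrite -size_poly_eq1 eqn_leq g_le1 size_poly_gt0.
  exact: dvd1p.
have [f irr_f /dvdpP[h def_g]] := exists_irreducible_factor g_gt1.
rewrite mulrC in def_g; subst g.
have cop_fh := sqfree_mul_coprimep irr_f (sqfree_dvdp dvd_gA sfA).
have [f_n0 h_n0] : f != 0 /\ h != 0.
  by move: g_n0; rewrite mulf_eq0 negb_or => /andP.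
have [||w ann_w] := IHm h; first 2 last.
- have dvd_fA := dvdp_trans (dvdp_mulr h (dvdpp f)) dvd_gA.
  have /eigenpolyP[u] := eigenpoly_irreducible_factor irr_f dvd_fA.
  rewrite /kermxpoly sub_kermx => /eqP fu0 u_n0.
  exists (u + w) => p; apply/eqP/idP => [up0|/dvdpP[k ->]]; last first.
    rewrite mulmxDl mulrCA horner_mx_rowM fu0 mul0mx add0r.
    by apply/eqP; rewrite ann_w !dvdp_mull.
  rewrite Gauss_dvdp //; apply/andP; split.
    (* Applying [h] removes [w], so [p * h] kills [u]; were it coprime to [f], Bezout would force
       [u = 0]. *)
    have: u *m horner_mx A (p * h) = 0.
      move: (congr1 (mulmx^~ (horner_mx A h)) up0).
      rewrite -horner_mx_rowM mulmxDl mul0mx.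
      have /eqP-> : w *m horner_mx A (p * h) == 0.
        by rewrite ann_w dvdp_mull.
      by rewrite addr0.
    rewrite -(Gauss_dvdpl _ cop_fh) => uph0; apply: contraNT u_n0.
    rewrite -irreducible_poly_coprime // => /Bezout_eq1_coprimepP[[a b] /= ab1].
    rewrite -[u]mulmx1 -[1%:M](rmorph1 (horner_mx A)) -ab1 rmorphD mulmxDr.
    rewrite mulrC horner_mx_rowM fu0 mul0mx add0r mulrC.
    by rewrite horner_mx_rowM uph0 mul0mx.
  (* Symmetrically, applying [f] removes [u], so [p * f] kills [w] and is a multiple of [h]. *)
  rewrite -(Gauss_dvdpl _ (q := f)) 1?coprimep_sym // -ann_w.
  move: (congr1 (mulmx^~ (horner_mx A f)) up0).
  rewrite -horner_mx_rowM mulmxDl mul0mx mulrC.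
  by rewrite horner_mx_rowM fu0 mul0mx add0r mulrC => ->.
- rewrite -ltnS; apply: leq_trans le_gm; rewrite size_mul // ltnS.
  by case: (size f) irr_f.1 => [|[|k]] //= _; rewrite ltnS leq_addl.
- by apply: dvdp_trans dvd_gA; apply: dvdp_mull.
Qed.

(** A relation between the rows is a polynomial of degree at most [n] killing [v]; as a multiple of
    the characteristic polynomial, of degree [n + 1], it vanishes. *)
Lemma krylov_unit_annihilator A v :
  (forall p, (v *m horner_mx A p == 0) = (char_poly A %| p)) ->
  krylov A v \in unitmx.
Proof.
move=> ann; rewrite -row_free_unit; apply: inj_row_free => u.
move/eqP; rewrite mul_krylov ann => dvd_Au; rewrite -[u]rVpolyK.
have [->|un0] := eqVneq (rVpoly u) 0; first by rewrite linear0.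
by have := dvdp_leq un0 dvd_Au; rewrite size_char_poly ltnNge size_poly.
Qed.

Lemma exists_cyclic_vector A :
  sqfree (char_poly A) -> exists v, krylov A v \in unitmx.
Proof.
move=> sfA; have [v ann] := exists_annihilated_by sfA (dvdpp _).
by exists v; apply: krylov_unit_annihilator.
Qed.

(** Coprimality gives an inverse by Bezout and Cayley-Hamilton. Conversely, let [g] be the gcd of
    [p] and [f = r * g]. Then [f] divides [p * r], so if [p] is invertible at [A], [r] vanishes at
    [A]; cyclicity of [v] forbids this when [r] has smaller degree than [f]. *)
Lemma horner_mx_unit A v p : krylov A v \in unitmx ->
  (horner_mx A p \in unitmx) = coprimep p (char_poly A).
Proof.
move=> uK.
apply/idP/idP => [up|/Bezout_eq1_coprimepP[[a b] /= ab1]]; last first.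
  have: horner_mx A (a * p + b * char_poly A) = 1 by rewrite ab1 rmorph1.
  rewrite rmorphD !rmorphM /= Cayley_Hamilton mulr0 addr0 -mulmxE.
  by move/mulmx1_unit => [].
set f := char_poly A; set g := gcdp p f.
have f_n0 : f != 0 by apply/monic_neq0/char_poly_monic.
have /dvdpP[r def_f] : g %| f by apply: dvdp_gcdr.
have /dvdpP[k def_p] : g %| p by apply: dvdp_gcdl.
have g_n0 : g != 0 by rewrite gcdp_eq0 negb_and f_n0 orbT.
have r_n0 : r != 0 by apply: contraNneq f_n0 => r0; rewrite def_f r0 mul0r.
have Ar0 : horner_mx A r = 0.
  apply: (can_inj (mulKmx up)); rewrite mulmx0 mulmxE -rmorphM /=.
  rewrite {1}def_p -mulrA [g * r]mulrC -def_f rmorphM /= Cayley_Hamilton.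
  by rewrite mulr0.
rewrite /coprimep -/g; apply: contraT => g_n1.
have sr : (size r <= n.+1)%N.
  have := size_char_poly A; rewrite -/f def_f size_mul //.
  move: g_n1; rewrite -size_poly_gt0 in g_n0.
  case: (size g) g_n0 => [|[|j]] // _ _; rewrite !addnS /= => -[<-].
  exact: leq_addr.
have: poly_rV r *m krylov A v = 0 by rewrite mul_krylov poly_rV_K // Ar0 mulmx0.
move/(congr1 (mulmx^~ (invmx (krylov A v)))); rewrite mulmxK // mul0mx => r0.
by rewrite -(poly_rV_K sr) r0 linear0 eqxx in r_n0.
Qed.

Lemma row0_krylov A v : row 0 (krylov A v) = v.
Proof. by rewrite rowK expr0 mulmx1. Qed.

Lemma row_krylov_mulmx A v (i : 'I_n.+1) :
  row i (krylov A v *m A) = v *m horner_mx A 'X^(i.+1).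
Proof.
by rewrite row_mul rowK -mulmxA mulmxE -exprSr rmorphXn /= horner_mx_X.
Qed.

(** The first row recovers [v]. By Cayley-Hamilton, reducing ['X^(i.+1)] modulo the common
    characteristic polynomial writes each row of [krylov A v *m A] as a combination of Krylov rows
    that is the same for [A] and [B]; the invertible Krylov matrix is then cancelled. *)
Lemma krylov_inj A B v w : char_poly A = char_poly B ->
  krylov A v \in unitmx -> krylov A v = krylov B w -> A = B /\ v = w.
Proof.
move=> eq_f uK eqK.
have eq_v : v = w by rewrite -(row0_krylov A v) eqK row0_krylov.
split=> //; apply: (can_inj (mulKmx uK)); rewrite {2}eqK.
apply/row_matrixP=> i; rewrite !row_krylov_mulmx.
pose r := 'X^(i.+1) %% char_poly A.
have f_n0 : char_poly A != 0 by apply/monic_neq0/char_poly_monic.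
have sr : (size r <= n.+1)%N by rewrite -ltnS -(size_char_poly A) ltn_modp.
have red C u : char_poly C = char_poly A ->
    u *m horner_mx C 'X^(i.+1) = poly_rV r *m krylov C u.
  move=> eqC; rewrite mul_krylov poly_rV_K //.
  rewrite (divp_eq 'X^(i.+1) (char_poly A)) -/r.
  by rewrite rmorphD rmorphM /= -{2}eqC Cayley_Hamilton mulr0 add0r.
by rewrite !red // eqK.
Qed.

(** The companion matrix shifts the standard basis rows, so the first one is cyclic with Krylov
    matrix the identity. *)
Lemma exists_companion f : f \is monic -> size f = n.+2 ->
  exists2 C, char_poly C = f & krylov C (delta_mx 0 0) = 1%:M.
Proof.
move=> mon_f sz_f; have := companionmxK mon_f.
have := @mulmx_delta_companion _ f.
move: (companionmx f); rewrite sz_f /= => C Cdelta charC; exists C => //.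
have CX k : (k < n.+1)%N ->
    delta_mx 0 0 *m C ^+ k = delta_mx 0 (inord k) :> 'rV_n.+1.
  elim: k => [|k IHk] lt_kn.
    by rewrite expr0 mulmx1; congr delta_mx; apply/val_inj; rewrite /= inordK.
  rewrite exprSr -mulmxE mulmxA IHk 1?ltnW //.
  have lt_k : ((inord k : 'I_n.+1).+1 < n.+1)%N by rewrite inordK // ltnW.
  by rewrite Cdelta; congr delta_mx; apply/val_inj; rewrite /= !inordK // ltnW.
by apply/row_matrixP=> i; rewrite rowK CX // inord_val row1.
Qed.

End Krylov.

Lemma char_poly_conj (R : comUnitRingType) n (P C : 'M[R]_n) : P \in unitmx ->
  char_poly (invmx P *m C *m P) = char_poly C.
Proof.
move=> uP.
pose Q := map_mx (@polyC R) P; pose Q' := map_mx (@polyC R) (invmx P).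
have Q'Q : Q' *m Q = 1%:M by rewrite -map_mxM mulVmx // map_mx1.
rewrite /char_poly.
have -> : char_poly_mx (invmx P *m C *m P) = Q' *m char_poly_mx C *m Q.
  rewrite /char_poly_mx mulmxBr mulmxBl !map_mxM; congr (_ - _).
  by rewrite scalar_mxC -mulmxA Q'Q mulmx1.
by rewrite !det_mulmx mulrAC -det_mulmx Q'Q det1 mul1r.
Qed.

(** * Counting matrices with a given square-free characteristic polynomial *)

Section Counting.
Variable F : finFieldType.
Implicit Types (f g : {poly F}).

(* For [size f = n.+1] this is the number of units of F[X]/(f). *)
Definition polyphi n f : nat := #|[set p : {poly_n F} | coprimep p f]|.

Lemma polyphi0 : polyphi 0 1 = 1%N.
Proof.
rewrite /polyphi; have -> : [set p : {poly_0 F} | coprimep p 1] = setT.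
  by apply/setP=> p; rewrite !inE coprimep1.
by rewrite cardsT card_npoly.
Qed.

(** For a fixed cyclic [v], every row is [v] times [p(A)] for a unique [p] of degree at most [n].
    Its Krylov matrix is that of [v] times [p(A)], hence invertible iff [p] is coprime to the
    characteristic polynomial. *)
Lemma card_cyclic_vectors n (A : 'M[F]_n.+1) : sqfree (char_poly A) ->
  #|[set v | krylov A v \in unitmx]| = polyphi n.+1 (char_poly A).
Proof.
move=> /exists_cyclic_vector[v uK].
pose h (p : {poly_(n.+1) F}) := v *m horner_mx A p.
have hE p : h p = poly_rV (p : {poly F}) *m krylov A v.
  by rewrite mul_krylov poly_rV_K // size_npoly.
have inj_h : injective h.
  move=> p1 p2; rewrite !hE => /(can_inj (mulmxK uK)) eq_p.
  apply/val_inj => /=.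
  by rewrite -(poly_rV_K (size_npoly p1)) eq_p poly_rV_K ?size_npoly.
rewrite /polyphi -(card_imset _ inj_h); congr #|pred_of_set _|.
apply/setP=> w; rewrite inE; apply/idP/imsetP => [uw|[p]].
  pose r := rVpoly (w *m invmx (krylov A v)).
  have sr : (size r <= n.+1)%N by apply: size_poly.
  have hr : w = h (npolyp n.+1 r).
    by rewrite hE npolypK // rVpolyK mulmxKV.
  exists (npolyp n.+1 r) => //; rewrite inE -(horner_mx_unit _ uK).
  by move: uw; rewrite hr krylov_mul unitmx_mul => /andP[].
rewrite inE => cop ->; rewrite krylov_mul unitmx_mul uK.
by rewrite (horner_mx_unit _ uK).
Qed.

(** Pairs of a matrix and a cyclic vector are counted twice: matrix by matrix, and through their
    Krylov matrices, which run once through GL(n,q). *)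
Lemma card_char_poly n f : f \is monic -> size f = n.+1 -> sqfree f ->
  (#|[set A : 'M[F]_n | char_poly A == f]| * polyphi n f = #|GLset F n|)%N.
Proof.
(* Krylov matrices have positive size; in size 0 both sides are 1. *)
case: n => [|n] mon_f sz_f sf_f.
  have f1 : f = 1.
    by apply/eqP; rewrite -eqp_monic ?monic1 // -size_poly_eq1 sz_f.
  have -> : [set A : 'M[F]_0 | char_poly A == f] = setT.
    by apply/setP=> A; rewrite !inE f1 /char_poly det_mx00 eqxx.
  have -> : GLset F 0 = setT.
    by apply/setP=> A; rewrite !inE unitmxE det_mx00 unitr1.
  by rewrite f1 polyphi0 muln1 !cardsT.
pose X := [set x : 'M[F]_n.+1 * 'rV[F]_n.+1 |
            (char_poly x.1 == f) && (krylov x.1 x.2 \in unitmx)].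
have cardX : #|X| =
    (\sum_(A : 'M[F]_n.+1 | char_poly A == f)
      #|[set v | krylov A v \in unitmx]|)%N.
  rewrite (eq_bigr (fun A => \sum_(v in [set v | krylov A v \in unitmx]) 1)%N);
    last by move=> A _; rewrite sum1_card.
  rewrite pair_big_dep -sum1_card /=; apply: eq_bigl => x.
  by rewrite !inE.
have -> : GLset F n.+1 = (fun x => krylov x.1 x.2) @: X.
  apply/setP=> P; rewrite inE; apply/idP/imsetP => [uP|[x]]; last first.
    by rewrite inE => /andP[_ uK] ->.
  have [C charC KC] := exists_companion mon_f sz_f.
  (* Conjugation by [P] carries a pair whose Krylov matrix is the identity to one whose Krylov
     matrix is [P]. *)
  have KP : krylov (invmx P *m C *m P) (delta_mx 0 0 *m P) = P.
    apply/row_matrixP=> i; rewrite rowK.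
    have -> : (invmx P *m C *m P) ^+ i = invmx P *m C ^+ i *m P.
      elim: (nat_of_ord i) => [|k IHk]; first by rewrite !expr0 mulmx1 mulVmx.
      rewrite !exprSr IHk -!mulmxE !mulmxA; congr (_ *m _ *m _).
      by rewrite mulmxK.
    by rewrite !mulmxA mulmxK // -[P in RHS]mul1mx -KC row_mul rowK.
  exists (invmx P *m C *m P, delta_mx 0 0 *m P); rewrite ?inE /= KP // uP andbT.
  by rewrite char_poly_conj // charC.
rewrite card_in_imset ?cardX => [|x y]; last first.
  rewrite !inE => /andP[/eqP fx ux] /andP[/eqP fy uy] eqK.
  have [] := krylov_inj _ ux eqK; first by rewrite fx fy.
  by case: x y {fx ux fy uy eqK} => ? ? [? ?] /= -> ->.
rewrite (eq_bigr (fun=> polyphi n.+1 f)) => [|A /eqP fA]; last first.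
  by rewrite card_cyclic_vectors fA.
by rewrite sum_nat_const -(cardsE (fun A => char_poly A == f)).
Qed.

Lemma polyphi_irreducible n f : irreducible_poly f -> size f = n.+1 ->
  polyphi n f = (#|F| ^ n - 1)%N.
Proof.
move=> irr_f sz_f; rewrite /polyphi -card_npoly.
have -> : [set p : {poly_n F} | coprimep p f] = [set~ 0].
  apply/setP=> p; rewrite !inE coprimep_sym irreducible_poly_coprime //.
  congr (~~ _); apply/idP/eqP => [dvd_fp|->]; last exact: dvdp0.
  apply/val_inj/eqP; apply: contraTT dvd_fp => p_n0.
  by apply/negP=> /(dvdp_leq p_n0); rewrite sz_f leqNgt ltnS size_npoly.
by rewrite cardsC1 subn1.
Qed.

(* Chinese remaindering; reduction is injective, hence bijective by counting. *)
Lemma polyphiM m n f g : size f = m.+1 -> size g = n.+1 -> coprimep f g ->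
  polyphi (m + n) (f * g) = (polyphi m f * polyphi n g)%N.
Proof.
move=> sz_f sz_g cop_fg.
have f_n0 : f != 0 by rewrite -size_poly_gt0 sz_f.
have g_n0 : g != 0 by rewrite -size_poly_gt0 sz_g.
have fmod (p : {poly F}) : (size (p %% f)%R <= m)%N.
  by rewrite -ltnS -sz_f ltn_modp.
have gmod (p : {poly F}) : (size (p %% g)%R <= n)%N.
  by rewrite -ltnS -sz_g ltn_modp.
pose h (p : {poly_(m + n) F}) := (npolyp m (p %% f), npolyp n (p %% g)).
have inj_h : injective h.
  move=> p1 p2 [/(congr1 (@polyn _ _)) + /(congr1 (@polyn _ _))].
  rewrite !npolypK // => eqf eqg; apply/val_inj/eqP; rewrite -subr_eq0 /=.
  have dvd_fg : f * g %| (p1 : {poly F}) - p2.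
    by rewrite Gauss_dvdp // /dvdp !modpD !modpN eqf eqg !subrr !eqxx.
  apply: contraTT dvd_fg => d_n0; apply/negP=> /(dvdp_leq d_n0).
  rewrite size_mul // sz_f sz_g addnS addSn /= leqNgt ltnS => /negP; apply.
  by rewrite (leq_trans (size_polyD _ _)) // size_polyN geq_max !size_npoly.
have bij_h : bijective h.
  apply: inj_card_bij inj_h _.
  by rewrite card_prod !card_npoly expnD.
rewrite /polyphi -cardsX -(on_card_preimset (onW_bij _ bij_h)).
congr #|pred_of_set _|; apply/setP=> p.
rewrite !inE coprimepMr !npolypK //.
by rewrite !coprimep_modl.
Qed.
End Counting.

(** * Products of distinct monic irreducible polynomials *)

Section MonicIrreducibleFactors.
Variable F : finFieldType.
Implicit Types (f g p : {poly F}) (s : seq {poly F}).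

(** Boolean, so that it can cut out finite sets of polynomials. *)
Definition mirr p := (p \is monic) && irreducibleb p.

Lemma mirr_monic p : mirr p -> p \is monic. Proof. by case/andP. Qed.

Lemma mirr_irreducible p : mirr p -> irreducible_poly p.
Proof. by case/andP=> _ /irreducibleP. Qed.

Lemma mirr_dvdp f g : mirr f -> mirr g -> (f %| g) = (f == g).
Proof.
move=> mf mg; apply/idP/eqP => [dvd_fg|->]; last exact: dvdpp.
apply/eqP; rewrite -eqp_monic ?mirr_monic //.
apply: (mirr_irreducible mg).2 dvd_fg.
by rewrite neq_ltn (mirr_irreducible mf).1 orbT.
Qed.

Lemma exists_mirr_factor p : (1 < size p)%N -> exists2 f, mirr f & f %| p.
Proof.
move=> /exists_irreducible_factor[f irr_f dvd_fp].
have lc_n0 : lead_coef f != 0 by rewrite lead_coef_eq0 irredp_neq0.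
exists ((lead_coef f)^-1 *: f).
  rewrite /mirr monicE lead_coefZ mulVf // eqxx; apply/irreducibleP; split.
    by rewrite size_scale ?invr_eq0 // irr_f.
  move=> d d_n1; rewrite dvdpZr ?invr_eq0 // => /(irr_f.2 _ d_n1) /eqp_trans.
  by apply; rewrite eqp_sym eqp_scale // invr_eq0.
by rewrite dvdpZl ?invr_eq0.
Qed.

Lemma monic_prod_mirr s : all mirr s -> \prod_(p <- s) p \is monic.
Proof.
by move=> /allP ms; rewrite big_seq; apply: monic_prod => p /ms/mirr_monic.
Qed.

Lemma dvdp_prod_mirr f s :
  mirr f -> all mirr s -> (f %| \prod_(p <- s) p) = (f \in s).
Proof.
move=> mf; elim: s => [|p s IHs] /=.
  by rewrite big_nil dvdp1 in_nil gtn_eqF // (mirr_irreducible mf).1.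
case/andP=> mp ms; rewrite big_cons inE -IHs // -mirr_dvdp //.
have [dvd_fp|] := boolP (f %| p); first by rewrite dvdp_mulr.
rewrite -irreducible_poly_coprime; last exact: mirr_irreducible.
by move/Gauss_dvdpr->.
Qed.

Lemma coprimep_prod_mirr f s :
  mirr f -> all mirr s -> f \notin s -> coprimep f (\prod_(p <- s) p).
Proof.
move=> mf ms nfs.
rewrite irreducible_poly_coprime; last exact: mirr_irreducible.
by rewrite dvdp_prod_mirr.
Qed.

Lemma size_prod_mirr s : all mirr s ->
  size (\prod_(p <- s) p) = (\sum_(p <- s) (size p).-1).+1.
Proof.
elim: s => [|p s IHs] /=; first by rewrite !big_nil size_poly1.
case/andP=> mp ms; have p_n0 := monic_neq0 (mirr_monic mp).
rewrite !big_cons size_mul ?(monic_neq0 (monic_prod_mirr ms)) // IHs //.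
by rewrite addnS /= -addSn prednK // size_poly_gt0.
Qed.

Lemma sqfree_prod_mirr s : uniq s -> all mirr s -> sqfree (\prod_(p <- s) p).
Proof.
move=> us ms d dvd_dd; rewrite leqNgt; apply/negP.
move=> /exists_mirr_factor[f mf dvd_fd].
have dvd_ff := dvdp_trans (dvdp_mul dvd_fd dvd_fd) dvd_dd.
have fs : f \in s by rewrite -dvdp_prod_mirr // (dvdp_trans _ dvd_ff) ?dvdp_mulr.
(* Cancelling one [f] leaves it dividing the product of the others, among which it no longer
   occurs. *)
move: dvd_ff; rewrite (big_rem _ fs) /= dvdp_mul2l ?monic_neq0 ?mirr_monic //.
rewrite dvdp_prod_mirr ?mem_rem_uniq ?inE ?eqxx //.
by apply/allP=> p /mem_rem/(allP ms).
Qed.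

Lemma prod_mirr_dvdp g s : uniq s -> all mirr s -> all (fun p => p %| g) s ->
  \prod_(p <- s) p %| g.
Proof.
elim: s => [|p s IHs] /=; first by rewrite big_nil dvd1p.
case/andP=> nps us /andP[mp ms] /andP[dp ds].
by rewrite big_cons Gauss_dvdp ?coprimep_prod_mirr // dp IHs.
Qed.

(** The product divides [g] by pairwise coprimality. An irreducible factor of the cofactor would
    divide [g], hence lie in [s], and its square would divide [g]. *)
Lemma sqfree_factorization g s : g \is monic -> sqfree g -> uniq s ->
  all mirr s -> (forall f, mirr f -> (f %| g) = (f \in s)) ->
  g = \prod_(p <- s) p.
Proof.
move=> mg sfg us ms sP.
have /dvdpP[k def_g] : \prod_(p <- s) p %| g.
  by apply: prod_mirr_dvdp => //; apply/allP=> p ps; rewrite sP // (allP ms).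
apply/eqP; rewrite -eqp_monic ?monic_prod_mirr // {1}def_g.
suff k1 : k %= 1 by have := eqp_mulr (\prod_(p <- s) p) k1; rewrite mul1r.
have k_n0 : k != 0.
  apply: contraTneq mg => k0.
  by rewrite def_g k0 mul0r monicE lead_coef0 eq_sym oner_eq0.
rewrite -size_poly_eq1 eqn_leq size_poly_gt0 k_n0 andbT leqNgt; apply/negP.
move=> /exists_mirr_factor[f mf dvd_fk].
have: f %| g by rewrite def_g dvdp_mulr.
rewrite sP // -dvdp_prod_mirr // => dvd_fs.
have := sfg f; rewrite def_g dvdp_mul // => /(_ isT).
by rewrite leqNgt (mirr_irreducible mf).1.
Qed.

Lemma polyphi_prod_mirr s : uniq s -> all mirr s ->
  polyphi (\sum_(p <- s) (size p).-1)%N (\prod_(p <- s) p) =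
  (\prod_(p <- s) (#|F| ^ (size p).-1 - 1))%N.
Proof.
elim: s => [|p s IHs] /=; first by rewrite !big_nil polyphi0.
case/andP=> nps us /andP[mp ms]; rewrite !big_cons.
have szp : size p = (size p).-1.+1.
  by rewrite prednK // size_poly_gt0 monic_neq0 ?mirr_monic.
rewrite polyphiM ?size_prod_mirr ?coprimep_prod_mirr // -IHs //.
by rewrite (polyphi_irreducible (mirr_irreducible mp) szp).
Qed.

End MonicIrreducibleFactors.

(** * The Euler product for separable matrices *)

Section SeparableGeneratingFunction.
Variable F : finFieldType.

Lemma card_expB1 d : (#|F| ^ d - 1)%N%:R = (#|F| ^ d)%:R - 1 :> rat.
Proof. by rewrite natrB // expn_gt0 ltnW // finNzRing_gt1. Qed.

Lemma coef_prod_1DX (I : finType) (A : {set I}) (a : I -> rat) (d : I -> nat) n :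
  (\prod_(i in A) (1 + a i *: 'X^(d i)))`_n =
  \sum_(J : {set I} | (J \subset A) && (\sum_(i in J) d i == n)%N)
    \prod_(i in J) a i.
Proof.
rewrite big_mkcond /=.
rewrite (eq_bigr (fun i => (if i \in A then a i *: 'X^(d i) else 0) + 1));
  last first.
  by move=> i _; case: ifP; rewrite ?add0r // addrC.
rewrite bigA_distr coef_sum [RHS]big_mkcond /=; apply: eq_bigr => J _.
rewrite -big_mkcond /=; have [sJA|] := boolP (J \subset A); last first.
  by case/subsetPn=> i iJ niA; rewrite (bigD1 i) //= (negPf niA) mul0r coef0.
rewrite (eq_bigr (fun i => a i *: 'X^(d i))) => [|i iJ]; last first.
  by rewrite (subsetP sJA).
rewrite scaler_prod coefZ -(big_morph _ (fun m k => exprD _ m k) (expr0 _)) /=.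
by rewrite coefXn eq_sym; case: eqP; rewrite ?mulr1 ?mulr0.
Qed.

(** Bounding degrees by [n] makes the set finite and suffices for coefficient [n]. The parameter [e]
    carries the excluded factors: ['X] for GL(n,q), ['X * ('X - 1%:P)] for A(n,q). *)
Definition mirrs n (e : {poly F}) : {set {poly_(n.+1) F}} :=
  [set p : {poly_(n.+1) F} | mirr p && coprimep p e].

(** Coprimality to ['X] expresses invertibility, coprimality to ['X - 1%:P] the absence of
    eigenvalue 1. *)
Definition sepset n (e : {poly F}) : {set 'M[F]_n} :=
  [set A : 'M[F]_n | separable_mx A && coprimep (char_poly A) e].

(** Matrices are sorted by the set [J] of monic irreducible factors of their characteristic
    polynomial. The sets whose degrees sum to [n] index the terms of coefficient [n], and by
    [card_char_poly] each class has the size its term predicts. *)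
Lemma sepset_coef n e :
  #|sepset n e|%:R / #|GLset F n|%:R =
  (\prod_(p in mirrs n e) factor #|F| (size (p : {poly F})).-1)`_n :> rat.
Proof.
(* The lists forget the degree bound, so that the results on sequences of polynomials apply. *)
pose lst (J : {set {poly_(n.+1) F}}) := [seq polyn p | p <- enum J].
have lst_uniq J : uniq (lst J).
  by rewrite map_inj_uniq ?enum_uniq //; apply: val_inj.
have lst_mem J (p : {poly_(n.+1) F}) : ((p : {poly F}) \in lst J) = (p \in J).
  by rewrite mem_map ?mem_enum //; apply: val_inj.
have lst_mirr (J : {set {poly_(n.+1) F}}) :
    J \subset mirrs n e -> all (@mirr F) (lst J).
  move=> sJ; apply/allP=> _ /mapP[p + ->]; rewrite mem_enum => /(subsetP sJ).
  by rewrite inE => /andP[].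
have prod_lst (R : Type) (i : R) (op : Monoid.com_law i)
    (J : {set {poly_(n.+1) F}}) (G : {poly F} -> R) :
   \big[op/i]_(p in J) G p = \big[op/i]_(p <- lst J) G p.
  by rewrite big_map big_enum.
pose fac (A : 'M[F]_n) := [set p in mirrs n e | (p : {poly F}) %| char_poly A].
rewrite /factor coef_prod_1DX.
pose Q (J : {set {poly_(n.+1) F}}) :=
  (J \subset mirrs n e) && (\sum_(p in J) (size (p : {poly F})).-1 == n)%N.
have charE A : A \in sepset n e -> char_poly A = \prod_(p <- lst (fac A)) p.
  rewrite inE => /andP[/asboolP sfA copA].
  apply: sqfree_factorization; rewrite ?char_poly_monic ?lst_mirr //.
    by apply/subsetP=> p; rewrite inE => /andP[].
  (* A polynomial too large for the bounded type neither divides the characteristic polynomial nor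
     occurs in the list. *)
  move=> f mf; have [szf|szf] := leqP (size f) n.+1; last first.
    apply/idP/idP => [dvd_fA|].
      have := dvdp_leq (monic_neq0 (char_poly_monic A)) dvd_fA.
      by rewrite size_char_poly leqNgt szf.
    by move/mapP=> [p _ def_f]; move: szf; rewrite def_f ltnNge size_npoly.
  rewrite -[f in RHS](npolypK szf) lst_mem !inE npolypK // mf /=.
  have [dvd_fA|] := boolP (f %| char_poly A); last by rewrite andbF.
  by rewrite andbT (coprimep_dvdr dvd_fA).
have facQ A : A \in sepset n e -> Q (fac A).
  move=> /charE charA.
  have sJ : fac A \subset mirrs n e by apply/subsetP=> p; rewrite inE => /andP[].
  have := size_char_poly A; rewrite charA size_prod_mirr ?lst_mirr // => -[szA].
  by rewrite /Q sJ (prod_lst _ _ _ _ (fun p => (size p).-1)) szA eqxx.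
(* The class of [J] is the set of all matrices with one prescribed square-free characteristic
   polynomial. *)
have facP A J : Q J -> ((A \in sepset n e) && (fac A == J)) =
                      (char_poly A == \prod_(p <- lst J) p).
  move=> /andP[sJ szJ]; apply/andP/eqP => [[/charE-> /eqP->] //|charA].
  have Jm := lst_mirr _ sJ; split.
    rewrite inE; apply/andP; split.
      by apply/asboolP; rewrite charA; apply: sqfree_prod_mirr.
    rewrite charA -(prod_lst _ _ _ _ (fun p => p)).
    apply: (big_ind (fun g => coprimep g e)) => [|f g cf cg|p /(subsetP sJ)].
    - exact: coprime1p.
    - by rewrite coprimepMl cf.
    - by rewrite inE => /andP[].
  apply/eqP/setP=> p; rewrite inE charA; apply/andP/idP => [[pm]|pJ].
    by rewrite dvdp_prod_mirr ?lst_mem //; move: pm; rewrite inE => /andP[].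
  have pm := subsetP sJ p pJ; split=> //.
  by rewrite dvdp_prod_mirr ?lst_mem //; move: pm; rewrite inE => /andP[].
rewrite -sum1_card (partition_big fac Q) //= natr_sum mulr_suml.
apply: eq_bigr => J QJ; have /andP[sJ /eqP szJ] := QJ.
rewrite (eq_bigl _ _ (fun A => facP A J QJ)) sum1dep_card.
have Jm := lst_mirr _ sJ.
have := @card_char_poly F n (\prod_(p <- lst J) p).
rewrite monic_prod_mirr // size_prod_mirr // -prod_lst szJ => /(_ isT erefl).
move/(_ (sqfree_prod_mirr (lst_uniq J) Jm)).
have -> : polyphi n (\prod_(p <- lst J) p) =
          (\prod_(p in J) (#|F| ^ (size (p : {poly F})).-1 - 1))%N.
  rewrite (prod_lst _ _ _ _ (fun p => #|F| ^ (size p).-1 - 1)%N).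
  rewrite -polyphi_prod_mirr //.
  by rewrite -(prod_lst _ _ _ _ (fun p => (size p).-1)) szJ.
set c := #|_|; set phi := (\prod_(p in J) _)%N => def_GL.
(* GL(n,q) contains the identity, so [c] is nonzero and cancels in the quotient. *)
have: (0 < c * phi)%N.
  by rewrite def_GL; apply/card_gt0P; exists 1%:M; rewrite inE unitmx1.
rewrite muln_gt0 => /andP[c_gt0 _].
rewrite -def_GL natrM invfM mulVKf ?pnatr_eq0 -?lt0n //.
rewrite natr_prod -prodfV; apply: eq_bigr => p _.
by rewrite card_expB1.
Qed.
End SeparableGeneratingFunction.

(** * The affine group in block form *)

Section Affine.
Variable F : finFieldType.
Implicit Types (p g : {poly F}).

Lemma coprimep_X p : coprimep p 'X = (p`_0 != 0).
Proof. by rewrite -['X]subr0 -polyC0 coprimep_XsubC rootE -horner_coef0. Qed.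

Lemma unitmx_coprimep n (A : 'M[F]_n) :
  (A \in unitmx) = coprimep (char_poly A) 'X.
Proof.
rewrite coprimep_X char_poly_det unitmxE unitfE mulf_eq0.
by rewrite expf_eq0 oppr_eq0 oner_eq0 andbF.
Qed.

(** If an irreducible [f] has its square dividing the product, either [f] is coprime to [X - c] and
    its square divides [g], or [f] is associate to [X - c], which then divides [g]. *)
Lemma sqfree_XsubC_mul (c : F) g :
  sqfree (('X - c%:P) * g) <-> sqfree g /\ coprimep g ('X - c%:P).
Proof.
split=> [sf|[sf_g cop]].
  split; first by apply: sqfree_dvdp sf; apply: dvdp_mull.
  by rewrite coprimep_sym; apply: sqfree_mul_coprimep sf; apply: irredp_XsubC.
move=> d dvd_d; rewrite leqNgt; apply/negP.
move=> /exists_irreducible_factor[f irr_f dvd_fd].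
have dvd_ff := dvdp_trans (dvdp_mul dvd_fd dvd_fd) dvd_d.
have [dvd_fX|] := boolP (f %| 'X - c%:P); last first.
  rewrite -irreducible_poly_coprime // => cop_fX.
  move: dvd_ff; rewrite Gauss_dvdpr ?coprimepMl ?cop_fX // => /sf_g.
  by rewrite leqNgt irr_f.1.
have f_n1 : size f != 1 by rewrite neq_ltn irr_f.1 orbT.
have eq_fX := (irredp_XsubC c).2 _ f_n1 dvd_fX.
have: ('X - c%:P) * ('X - c%:P) %| ('X - c%:P) * g.
  have dvd_Xf : 'X - c%:P %| f by rewrite (eqp_dvdr _ eq_fX).
  exact: dvdp_trans (dvdp_mul dvd_Xf dvd_Xf) dvd_ff.
rewrite dvdp_mul2l ?polyXsubC_eq0 // => dvd_Xg.
move: cop; rewrite coprimep_sym irreducible_poly_coprime ?dvd_Xg //.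
exact: irredp_XsubC.
Qed.

Definition affmx n (x : 'rV[F]_n * 'M[F]_n) : 'M[F]_n.+1 :=
  block_mx (1%:M : 'M_1) x.1 0 x.2.

Lemma affmx_inj n : injective (@affmx n).
Proof. by move=> [v y] [w z] /(@eq_block_mx _ 1 n 1 n)[_ /= -> _ ->]. Qed.

Lemma char_poly_affmx n (x : 'rV[F]_n * 'M[F]_n) :
  char_poly (affmx x) = ('X - 1%:P) * char_poly x.2.
Proof.
rewrite {1}/char_poly.
have -> : char_poly_mx (affmx x) = block_mx ('X - 1%:P)%:M
    (- map_mx polyC x.1) (0 : 'M_(n, 1)) (char_poly_mx x.2).
  rewrite /char_poly_mx /affmx (@map_block_mx _ _ polyC 1 n 1 n) map_mx0.
  rewrite (@scalar_mx_block _ 1 n) (@opp_block_mx _ 1 n 1 n).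
  rewrite (@add_block_mx _ 1 n 1 n).
  by rewrite map_scalar_mx oppr0 !add0r raddfB.
by rewrite /char_poly (@det_ublock _ 1 n) det_scalar1.
Qed.

Lemma separable_affmx n (x : 'rV[F]_n * 'M[F]_n) :
  separable_mx (affmx x) = (x.2 \in sepset n ('X - 1%:P)).
Proof.
rewrite inE /separable_mx char_poly_affmx; apply/asboolP/andP.
  by case/sqfree_XsubC_mul=> sf cop; split=> //; apply/asboolP.
by case=> /asboolP sf cop; apply/sqfree_XsubC_mul.
Qed.

Lemma unitmx_affmx n (x : 'rV[F]_n * 'M[F]_n) :
  (affmx x \in unitmx) = (x.2 \in unitmx).
Proof. by rewrite !unitmxE (@det_ublock _ 1 n) det1 mul1r. Qed.

Lemma Aset_affmx n : Aset F n = @affmx n @: (setX setT (GLset F n)).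
Proof.
have ord0E : ord0 = @lshift 1 n ord0 by apply/val_inj.
apply/setP=> x; apply/idP/imsetP => [|[[v y]]]; last first.
  rewrite !inE /= => uy ->; rewrite unitmx_affmx uy /= ord0E.
  rewrite /affmx (@block_mxEul _ 1 n 1 n) mxE !eqxx /=.
  apply/forallP=> j; apply/implyP; rewrite -[j](@splitK 1 n).
  case: (@split 1 n j) => i /=; first by rewrite (ord1 i) eqxx.
  by rewrite (@block_mxEdl _ 1 n 1 n) mxE.
rewrite inE => /andP[/andP[ux /eqP x00] /forallP x0].
have def_x : x = affmx (@ursubmx _ 1 n 1 n x, @drsubmx _ 1 n 1 n x).
  rewrite -[LHS](@submxK _ 1 n 1 n) /affmx; congr (@block_mx _ 1 n 1 n _ _ _ _).
    by apply/matrixP=> i j; rewrite !ord1 !mxE /= -ord0E x00.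
  apply/matrixP=> i j; rewrite !ord1 !mxE -ord0E.
  by apply/eqP/(implyP (x0 _)).
exists (@ursubmx _ 1 n 1 n x, @drsubmx _ 1 n 1 n x) => //.
by rewrite !inE -unitmx_affmx -def_x.
Qed.

Lemma s_GL_sepset n :
  s_GL F n = #|sepset n ('X : {poly F})|%:R / #|GLset F n|%:R.
Proof.
rewrite /s_GL; congr (#|pred_of_set _|%:R / _).
by apply/setP=> x; rewrite !inE andbC unitmx_coprimep.
Qed.

Lemma s_A_sepset n :
  s_A F n = #|sepset n ('X * ('X - 1%:P) : {poly F})|%:R / #|GLset F n|%:R.
Proof.
rewrite /s_A.
have -> : [set x in Aset F n | separable_mx x] =
   @affmx n @: (setX setT (sepset n ('X * ('X - 1%:P)))).
  apply/setP=> x; rewrite inE Aset_affmx.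
  apply/andP/imsetP => [[/imsetP[y yG ->]]|[y ys ->]].
    rewrite separable_affmx => ys; exists y => //; move: yG ys; rewrite !inE /=.
    by rewrite coprimepMr -unitmx_coprimep => -> /andP[-> ->].
  have := ys; rewrite !inE coprimepMr -unitmx_coprimep /= => /and3P[sy uy cy].
  rewrite separable_affmx inE sy cy; split=> //.
  by apply/imset_f; rewrite !inE.
rewrite Aset_affmx !(card_imset _ (@affmx_inj n)) !cardsX !natrM.
(* The arbitrary row of the block form contributes the same factor to numerator and denominator. *)
rewrite -mulf_div divff ?mul1r //.
by rewrite pnatr_eq0 -lt0n; apply/card_gt0P; exists 0; rewrite inE.
Qed.
End Affine.

(** * Counting irreducible factors by degree *)

Section CountByDegree.
Variable F : finFieldType.

(** Reconciles two encodings of a monic polynomial: the tuple of its lower coefficients, and an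
    element of the space of polynomials of bounded size. *)
Lemma card_mirr_degree n d : (d <= n)%N ->
  #|[set p : {poly_(n.+1) F} | mirr p && (size (p : {poly F}) == d.+1)]| =
  Nirr F d.
Proof.
move=> le_dn; pose P (c : d.-tuple F) : {poly F} := 'X^d + \poly_(i < d) c`_i.
have lt_sz (c : d.-tuple F) :
    (size (\poly_(i < d) c`_i)%R < size ('X^d : {poly F})%R)%N.
  by rewrite size_polyXn ltnS size_poly.
have szP c : size (P c) = d.+1 by rewrite size_polyDl // size_polyXn.
have monP c : P c \is monic by rewrite monicE lead_coefDl ?lead_coefXn.
have leP c : (size (P c) <= n.+1)%N by rewrite szP ltnS.
have inj_P : injective (fun c => npolyp n.+1 (P c)).
  move=> c1 c2 /(congr1 (@polyn _ _)); rewrite !npolypK // => /addrI eqp.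
  apply/val_inj/(@eq_from_nth _ 0); rewrite ?size_tuple // => i lt_id.
  by have := congr1 (fun p : {poly F} => p`_i) eqp; rewrite !coef_poly lt_id.
rewrite /Nirr -(card_imset _ inj_P); congr #|pred_of_set _|.
apply/setP=> p; rewrite inE; apply/idP/imsetP => [/andP[mp /eqP szp]|[c]].
  pose c := [tuple (p : {poly F})`_i | i < d].
  have def_p : (p : {poly F}) = P c.
    apply/polyP=> i; rewrite coefD coefXn coef_poly.
    case: ltngtP => [lt_id|lt_di|->].
    - by rewrite add0r (nth_map (Ordinal lt_id)) ?size_enum_ord // nth_enum_ord.
    - by rewrite addr0 nth_default // szp.
    - by rewrite addr0; have /monicP := mirr_monic mp; rewrite /lead_coef szp.
  exists c; last by apply/val_inj; rewrite /= npolypK.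
  by rewrite inE; apply/asboolP; rewrite -/(P c) -def_p; apply: mirr_irreducible.
rewrite inE => /asboolP/irreducibleP irr_c ->.
by rewrite npolypK // szP eqxx /mirr monP irr_c.
Qed.

Lemma mirr_XsubC (c : F) : mirr ('X - c%:P).
Proof. by rewrite /mirr monicXsubC; apply/irreducibleP/irredp_XsubC. Qed.

Lemma coprimep_mirr_XsubC (p : {poly F}) c :
  mirr p -> coprimep p ('X - c%:P) = (p != 'X - c%:P).
Proof.
move=> mp; rewrite irreducible_poly_coprime; last exact: mirr_irreducible.
by rewrite mirr_dvdp ?mirr_XsubC.
Qed.

(** The only monic irreducibles sharing a factor with [X (X - 1)] are [X] and [X - 1], distinct and
    of degree 1, whence the 2 subtracted in degree 1 only. *)
Lemma card_mirrs_degree n d : (0 < d <= n)%N ->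
  #|[set p in mirrs n ('X * ('X - 1%:P)) | (size (p : {poly F})).-1 == d]| =
  Nirr' F d.
Proof.
case/andP=> d_gt0 le_dn; rewrite /Nirr' -!(card_mirr_degree le_dn).
set D := [set p : {poly_(n.+1) F} | mirr p && (size (p : {poly F}) == d.+1)].
have X0 : 'X = 'X - 0%:P :> {poly F} by rewrite polyC0 subr0.
have memE p : (p \in [set p in mirrs n ('X * ('X - 1%:P)) |
                        (size (p : {poly F})).-1 == d]) =
    [&& p \in D, (p : {poly F}) != 'X - 0%:P & (p : {poly F}) != 'X - 1%:P].
  rewrite !inE coprimepMr; have [mp|] := boolP (mirr p) => //=.
  have szp : (0 < size (p : {poly F}))%N.
    by rewrite ltnW // (mirr_irreducible mp).1.
  by rewrite -!(coprimep_mirr_XsubC _ mp) -X0 -eqSS prednK // andbC.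
case: eqP => [d1|dn1]; last first.
  apply: eq_card => p; rewrite memE; have [|] := boolP (p \in D) => //=.
  rewrite inE => /andP[_ /eqP szp]; apply/andP; split; apply/eqP=> eqp;
    by move: szp; rewrite eqp size_XsubC => -[d1]; apply: dn1.
subst d; rewrite -(card_mirr_degree le_dn) -/D.
have szX (c : F) : (size ('X - c%:P)%R <= n.+1)%N by rewrite size_XsubC.
pose Y c : {poly_(n.+1) F} := npolyp n.+1 ('X - c%:P).
have YE (p : {poly_(n.+1) F}) c : ((p : {poly F}) != 'X - c%:P) = (p != Y c).
  by rewrite -(val_eqE p) /= npolypK.
have YD c : Y c \in D by rewrite inE npolypK // mirr_XsubC size_XsubC.
rewrite (cardsD1 (Y 0) D) YD (cardsD1 (Y 1) (D :\ Y 0)) in_setD1 YD.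
have -> : Y 1 != Y 0.
  rewrite -YE npolypK // (inj_eq (addrI _)) eqr_opp (inj_eq (@polyC_inj _)).
  exact: oner_neq0.
rewrite /= add1n add1n subn2 /=.
apply: eq_card => p; rewrite memE !in_setD1 !YE.
by case: (p \in D); case: (p != Y 0); case: (p != Y 1).
Qed.

Lemma prod_factor_mirrs n :
  \prod_(p in mirrs n ('X * ('X - 1%:P))) factor #|F| (size (p : {poly F})).-1 =
  \prod_(1 <= d < n.+1) factor #|F| d ^+ Nirr' F d.
Proof.
have deg_lt p : p \in mirrs n ('X * ('X - 1%:P)) ->
    (0 < (size (p : {poly F})).-1 < n.+1)%N.
  rewrite inE => /andP[/mirr_irreducible[szp _] _].
  by have := size_npoly p; case: (size _) szp => [|[|k]].
pose deg (p : {poly_(n.+1) F}) : 'I_n.+1 := inord (size (p : {poly F})).-1.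
rewrite big_geq_mkord (partition_big deg (fun i => 0 < i)%N); last first.
  by move=> p /deg_lt/andP[d0 dn]; rewrite /deg inordK.
apply: eq_bigr => i i_gt0.
have i_bounds : (0 < i <= n)%N by rewrite i_gt0 -ltnS ltn_ord.
rewrite -(card_mirrs_degree i_bounds).
rewrite (eq_bigr (fun=> factor #|F| i)); last first.
  by move=> p /andP[/deg_lt/andP[_ dn] /eqP <-]; rewrite /deg inordK.
rewrite prodr_const; congr (_ ^+ _); apply: eq_card => p.
rewrite unfold_in [RHS]in_set; case pm: (p \in _) => //=.
by have /andP[_ dn] := deg_lt _ pm; rewrite -val_eqE /= inordK.
Qed.

(** [factor] is 1 plus a multiple of ['X^(m.+1)], too high to reach coefficient [m]; this justifies
    truncating the infinite product. *)
Lemma coef_mul_factor_exp (p : {poly rat}) m k :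
  (p * factor #|F| m.+1 ^+ k)`_m = p`_m.
Proof.
elim: k => [|k IHk]; first by rewrite expr0 mulr1.
rewrite exprSr mulrA /factor mulrDr mulr1 coefD -scalerAr coefZ coefMXn ltnSn.
by rewrite mulr0 addr0 IHk.
Qed.

(** Passing from A(n,q) to GL(n,q) restores [X - 1] alone; it fits under the degree bound only for
    positive [n]. *)
Lemma mirrs_X n : (0 < n)%N ->
  mirrs n ('X : {poly F}) =
  npolyp n.+1 ('X - 1%:P) |: mirrs n ('X * ('X - 1%:P)).
Proof.
move=> n_gt0; have szX : (size ('X - 1%:P : {poly F})%R <= n.+1)%N.
  by rewrite size_XsubC ltnS.
apply/setP=> p; rewrite !inE coprimepMr -(val_eqE p) /= npolypK //.
have [mp|] /= := boolP (mirr p); last first.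
  by rewrite orbF => nmp; apply/esym; apply: contraNF nmp => /eqP ->; apply: mirr_XsubC.
rewrite (coprimep_mirr_XsubC 1 mp); case: eqP => [->|_] /=; last by rewrite andbT.
by rewrite coprimep_X !coefE sub0r oppr_eq0 oner_neq0.
Qed.
End CountByDegree.

(** Power series are compared coefficient by coefficient: coefficient [n] involves only the factors
    with [d <= n] and the terms with [k <= n]. The quotient is stated as a product, multiplied out
    by [1 + u/(q-1)]. *)
Theorem theorem5p3 (F : finFieldType) :
  forall n : nat,
    s_A F n = (\prod_(1 <= d < n.+1) factor #|F| d ^+ Nirr' F d)`_n /\
    s_GL F n = ((\sum_(k < n.+1) s_A F k *: 'X^k)
                  * (1 + ((#|F|%:R - 1)^-1 : rat) *: 'X))`_n.
Proof.
have sA n : s_A F n = (\prod_(1 <= d < n.+1) factor #|F| d ^+ Nirr' F d)`_n.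
  by rewrite s_A_sepset sepset_coef prod_factor_mirrs.
have coefS n k : (k < n)%N -> (\sum_(i < n) s_A F i *: 'X^i)`_k = s_A F k.
  by move=> lt_kn; rewrite -(poly_def n (s_A F)) coef_poly lt_kn.
move=> n; split=> //; rewrite s_GL_sepset sepset_coef.
rewrite mulrDr mulr1 coefD -scalerAr coefZ coefMX coefS //.
case: n => [|n] /=.
  (* No irreducible polynomial has degree 0, so both products are empty. *)
  rewrite mulr0 addr0 sA big_geq // big1 // => p.
  rewrite inE => /andP[/mirr_irreducible[szp _] _].
  by have := size_npoly p; rewrite leqNgt szp.
have szX : (size ('X - 1%:P : {poly F})%R <= n.+2)%N by rewrite size_XsubC.
(* The restored polynomial [X - 1] contributes the factor [1 + u/(q-1)]. *)
rewrite mirrs_X // big_setU1 /=; last first.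
  by rewrite inE npolypK // !coprimepMr coprimepp size_XsubC !andbF.
rewrite npolypK // size_XsubC prod_factor_mirrs /factor expn1.
rewrite mulrDl mul1r coefD -sA -scalerAl coefZ coefXM /= coefS //.
(* The product runs to [d = n + 1], one further than in [s_A F n]; the last factor leaves
   coefficient [n] unchanged. *)
by rewrite big_nat_recr //= coef_mul_factor_exp -sA.
Qed.
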